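(* Let $u$ be an upcycle for $A^n$ with diamondicity $d$, where $a=|A|$. Select a nonempty $n$-periodic subset of the diamonds in $u$, and let $\delta$ be the number of selected diamonds per window. Let $w$ be the cyclic partial word obtained by taking the cyclic partial word $u^{(a^\delta)}$ and replacing all the selected diamonds (and their copies), in order, with the letters of a cyclic word $v$ over $A$. Then $w$ is an upcycle for $A^n$ if and only if $v$ is an $\left(a,\,\delta,\,\frac{\delta a^{n-d}}{n}\right)$-perfect necklace. If so, then $w$ is a lift of $u$ with diamondicity $d-\delta$.
   Context: Let $A=\{0,\dots,a-1\}$, $a\ge 2$, be an alphabet and $\diamond\notin A$ a wildcard symbol (''diamond''). A partial word is a finite sequence over $A\cup\{\diamond\}$; a cyclic (partial) word $(u_1\cdots u_N)$ is cyclically ordered, with indices taken modulo $N$. A partial word $x$ covers a partial word $y$ of the same length if for each $i$ either $x_i=\diamond$ or $x_i=y_i$; a cyclic partial word covers a cyclic partial word of the same length if this holds for a suitable alignment (rotation). For $n\ge 1$, the window of $u$ at position $i\in\{1,\dots,N\}$ is $u_i\cdots u_{i+n-1}$. An upcycle for $A^n$ is a cyclic partial word $u=(u_1\cdots u_N)$ such that each word of $A^n$ is covered by the window at exactly one position $i\in\{1,\dots,N\}$. It is known that the diamonds of an upcycle are $n$-periodic ($u_i=\diamond$ implies $u_{i+n}=\diamond$), so all windows contain the same number $d$ of diamonds, called the diamondicity; then $u$ has length $a^{n-d}$. A subset of the diamonds of $u$ is $n$-periodic if whenever the diamond at position $i$ belongs to it, so does the diamond at position $i+n$ (indices modulo $|u|$);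 then each window contains the same number $\delta$ of selected diamonds, and $u$ contains $\frac{\delta a^{n-d}}{n}$ selected diamonds in total. $u^{(q)}$ denotes the cyclic concatenation of $q$ copies of $u$. The cyclic word $v$ has length $\frac{\delta a^{n-d}}{n}a^\delta$, the total number of selected diamonds and copies in $u^{(a^\delta)}$. If $u$ and $w$ are upcycles for $A^n$ with diamondicities $d$ and $d'$ respectively, where $d'<d$, then $w$ is a lift of $u$ if $w$ is covered by $u^{(a^{d-d'})}$. An $(a,n,t)$-perfect necklace is a cyclic word $v$ over $\{0,\dots,a-1\}$ of length $t\cdot a^n$ such that for every $j\in\{1,\dots,t\}$, each word of $\{0,\dots,a-1\}^n$ equals $v_i\cdots v_{i+n-1}$ for a unique $i\in\{1,\dots,ta^n\}$ with $i\equiv j\pmod t$. *)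

(* Defs.v *)
From mathcomp Require Import all_boot.

Set Implicit Arguments.
Unset Strict Implicit.
Unset Printing Implicit Defensive.

(* The diamond is None and the letters are Some c.  A cyclic word is given by
   a representative sequence, with 0-based indices read modulo its size; the
   properties below do not depend on the representative. *)
Definition pword (a : nat) : Type := seq (option 'I_a).

Definition letters (a : nat) (x : seq 'I_a) : pword a := map Some x.

(* The default None is never reached unless u is empty: n may exceed size u,
   in which case the window wraps around u several times. *)
Definition window (a n : nat) (u : pword a) (i : nat) : pword a :=
  mkseq (fun k => nth None u ((i + k) %% size u)) n.

(* all2 also requires the two words to have the same size. *)
Definition covers (a : nat) (x y : pword a) : bool :=
  all2 (fun p q => (p == None) || (p == q)) x y.

Definition ccovers (a : nat) (x y : pword a) : Prop :=
  exists r : nat, covers x (rot r y).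

Definition is_upcycle (a n : nat) (u : pword a) : Prop :=
  forall x : n.-tuple 'I_a,
    exists! i : 'I_(size u), covers (window n u i) (letters x).

Definition has_diamondicity (a n : nat) (u : pword a) (d : nat) : Prop :=
  forall i : nat, count (pred1 None) (window n u i) = d.

Definition copies (a q : nat) (u : pword a) : pword a := flatten (nseq q u).

Definition is_lift (a n : nat) (u w : pword a) : Prop :=
  exists d d' : nat,
    [/\ is_upcycle n u /\ has_diamondicity n u d,
        is_upcycle n w /\ has_diamondicity n w d',
        d' < d
      & ccovers (copies (a ^ (d - d')) u) w].

(* Residues j are taken in 0, ..., t - 1, in accordance with 0-based positions. *)
Definition is_perfect_necklace (a n t : nat) (v : seq 'I_a) : Prop :=
  size v = t * a ^ n /\
  forall (j : 'I_t) (x : n.-tuple 'I_a),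
    exists! i : 'I_(size v),
      i = j %[mod t] /\ window n (letters v) i = letters x.

(* A set of positions of a cyclic word of size N, extended to all indices. *)
Definition selected (N : nat) (S : {set 'I_N}) (p : nat) : bool :=
  [exists i in S, val i == p %% N].

Definition periodic (n N : nat) (S : {set 'I_N}) : Prop :=
  forall p : nat, selected S p -> selected S (p + n).

(* The selected position p of the q copies of u receives the letter of v whose
   index is the number of selected positions before p. *)
Definition fill (a q : nat) (u : pword a) (S : {set 'I_(size u)})
    (v : seq 'I_a) : pword a :=
  mkseq (fun p => if selected S p
                  then nth None (letters v) (count (selected S) (iota 0 p))
                  else nth None (copies q u) p)
        (q * size u).

(* Main.v *)
(** Let N = |u|, let T be the number of selected diamonds in u, and let c(p) be
    the number of selected positions before p.  The window of w at i covers x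
    iff the window of u at i covers x and the factor of v of length delta at
    c(i) spells the letters of x at the selected positions of that window.
    The first condition determines i modulo N, hence c(i) modulo T, while the
    positions i modulo a^delta N in one class modulo N correspond through c to
    the positions of v in one class modulo T.  So a unique i for each x amounts
    to a unique position of v for each residue and each word of length delta;
    conversely every residue is a value of c, and every word of length delta
    arises from an x covered by the window of u at that place. *)

Require Import Defs.
From mathcomp Require Import all_boot.

Set Implicit Arguments.
Unset Strict Implicit.
Unset Printing Implicit Defensive.

(** * Windows, covering and the length of an upcycle *)

Lemma nth_window (a n : nat) (u : pword a) (i k : nat) :
  k < n -> nth None (window n u i) k = nth None u ((i + k) %% size u).
Proof. exact: nth_mkseq. Qed.

Lemma window_eqmod (a n : nat) (u : pword a) (i j : nat) :
  i = j %[mod size u] -> window n u i = window n u j.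
Proof.
by move=> ij; apply: eq_mkseq => k; rewrite -modnDml ij modnDml.
Qed.

Lemma covers_windowP (a n : nat) (u : pword a) (i : nat) (x : n.-tuple 'I_a) :
  reflect (forall k : 'I_n, let z := nth None u ((i + k) %% size u) in
             (z == None) || (z == Some (tnth x k)))
          (covers (window n u i) (letters x)).
Proof.
rewrite /covers all2E size_mkseq size_map size_tuple eqxx /=.
apply: (iffP (all_nthP (None, None))) => [H k | H k].
  have := H k; rewrite size_zip size_mkseq size_map size_tuple minnn ltn_ord.
  rewrite nth_zip ?size_mkseq ?size_map ?size_tuple //= nth_window //.
  rewrite (nth_map (tnth x k)) ?size_tuple // -tnth_nth.
  by apply.
rewrite size_zip size_mkseq size_map size_tuple minnn => kn.
have := H (Ordinal kn).
rewrite nth_zip ?size_mkseq ?size_map ?size_tuple //= nth_window //.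
by rewrite (nth_map (tnth x (Ordinal kn))) ?size_tuple // -(tnth_nth _ x (Ordinal kn)).
Qed.

(** Carries uniqueness from ordinals over to arbitrary indices, so that positions can be shifted by
    whole periods without reduction. *)
Lemma upcycle_window_eqmod (a n : nat) (u : pword a) (x : n.-tuple 'I_a)
    (i j : nat) :
  is_upcycle n u -> 0 < size u ->
  covers (window n u i) (letters x) -> covers (window n u j) (letters x) ->
  i = j %[mod size u].
Proof.
move=> hu u0 ci cj; have [k [_ uk]] := hu x.
have im : i %% size u < size u by rewrite ltn_mod.
have jm : j %% size u < size u by rewrite ltn_mod.
have ki : k = Ordinal im by apply: uk; rewrite /= (window_eqmod _ (modn_mod _ _)).
have kj : k = Ordinal jm by apply: uk; rewrite /= (window_eqmod _ (modn_mod _ _)).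
by move: ki; rewrite kj => -[].
Qed.

(** Covering is a product of independent conditions on the letters of [x], so the sum factors over
    the places of the window: a diamond contributes [a], a letter contributes 1. *)
Lemma sum_covers_window (a n : nat) (u : pword a) (i : nat) :
  \sum_(x : n.-tuple 'I_a) covers (window n u i) (letters x) =
  a ^ count (pred1 None) (window n u i).
Proof.
pose z (k : 'I_n) := nth None u ((i + k) %% size u).
pose F (k : 'I_n) (c : 'I_a) : nat := (z k == None) || (z k == Some c).
transitivity (\prod_k \sum_c F k c).
  rewrite bigA_distr_bigA /=.
  rewrite (reindex (fun f : {ffun 'I_n -> 'I_a} => [tuple f k | k < n])) /=.
    apply: eq_bigr => f _.
    case: (covers_windowP u i [tuple f k | k < n]) => [H | H].
      by rewrite big1 // => k _; have := H k; rewrite tnth_mktuple /F /= => ->.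
    have [k Hk | H1] := pickP (fun k => F k (f k) == 0).
      by rewrite (bigD1 k) //= (eqP Hk).
    case: H => k /=; rewrite tnth_mktuple.
    by have := H1 k; rewrite /F /z; case: (_ || _).
  exists (fun x : n.-tuple 'I_a => [ffun k => tnth x k]) => x _.
    by apply/ffunP => k; rewrite ffunE tnth_mktuple.
  by apply: eq_from_tnth => k; rewrite tnth_mktuple ffunE.
transitivity (\prod_k (if z k == None then a else 1)).
  apply: eq_bigr => k _; rewrite /F; case: (z k) => [c|] /=.
    rewrite (bigD1 c) //= eqxx big1 // => e ec.
    by case: eqP => // -[ce]; rewrite ce eqxx in ec.
  by rewrite sum1_card card_ord.
rewrite -big_mkcond prod_nat_const; congr (a ^ _).
rewrite count_map -sum1_count -sum1_card -[n in iota 0 n]subn0 -/(index_iota 0 n) big_mkord.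
by apply: eq_bigl => k; rewrite unfold_in.
Qed.

(** Double counting of the pairs of a word and a window covering it: each word has one window, each
    window covers [a ^ d] words. *)
Lemma upcycle_size (a n d : nat) (u : pword a) :
  0 < a -> is_upcycle n u -> has_diamondicity n u d -> size u = a ^ (n - d).
Proof.
move=> a0 hu hd.
have dn : d <= n.
  by rewrite -(hd 0) (leq_trans (count_size _ _)) // size_mkseq.
have: \sum_(x : n.-tuple 'I_a) \sum_(i < size u)
        covers (window n u i) (letters x) = a ^ n.
  transitivity (\sum_(x : n.-tuple 'I_a) 1).
    apply: eq_bigr => x _; have [i [ci ui]] := hu x.
    rewrite (bigD1 i) //= ci big1 // => j /eqP ji.
    by case: (boolP (covers _ _)) => // /ui ij; case: ji.
  by rewrite sum1_card card_tuple card_ord.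
rewrite exchange_big /=.
under eq_bigr => i _ do rewrite sum_covers_window hd.
rewrite sum_nat_const card_ord => H.
apply/eqP; rewrite -(@eqn_pmul2r (a ^ d)) ?expn_gt0 ?a0 //.
by rewrite H -expnD subnK.
Qed.

(** * Ranks: counting the selected positions before a given one *)

Lemma count_iotaD (s : pred nat) (i n : nat) :
  count (fun k => s (i + k)) (iota 0 n) = count s (iota i n).
Proof. by rewrite -[i in RHS]addn0 iotaDl count_map. Qed.

Definition rank (s : pred nat) (p : nat) : nat := count s (iota 0 p).

Lemma rankD (s : pred nat) (p q : nat) :
  rank s (p + q) = rank s p + count s (iota p q).
Proof. by rewrite /rank iotaD count_cat. Qed.

Lemma ltn_rank (s : pred nat) (p m : nat) : s p -> p < m -> rank s p < rank s m.
Proof.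
move=> sp /subnKC <-; rewrite rankD -[p.+1]addn1 rankD /= sp.
by rewrite (leq_trans _ (leq_addr _ _)) // addn1.
Qed.

(** The rank starts at 0 and grows by at most 1 per step, so it skips no value. *)
Lemma rank_surj (s : pred nat) (m j : nat) :
  j <= rank s m -> exists p, rank s p = j.
Proof.
elim: m => [|m IHm]; first by rewrite leqn0 => /eqP ->; exists 0.
have [/IHm // | jm] := leqP j (rank s m).
rewrite -addn1 rankD /= addn0 => jm1; exists (m + 1).
rewrite rankD /= addn0; apply/eqP; rewrite eqn_leq jm1 andbT.
by rewrite (leq_trans _ jm) // -addn1 leq_add2l leq_b1.
Qed.

(** Selected positions inside a window have consecutive ranks; this is why such a window reads a
    factor of [v]. *)
Lemma map_rank_iota (s : pred nat) (i n : nat) :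
  [seq rank s (i + k) | k <- iota 0 n & s (i + k)] =
  iota (rank s i) (count s (iota i n)).
Proof.
elim: n => [|n IHn] //.
rewrite -addn1 !iotaD filter_cat map_cat IHn count_cat iotaD; congr (_ ++ _).
by rewrite /= -rankD addn0; case: (s (i + n)).
Qed.

Section PeriodicRank.

Variables (s : pred nat) (N : nat).
Hypothesis sN : forall p, s (p + N) = s p.

Lemma periodic_mul (p q : nat) : s (p + q * N) = s p.
Proof. by elim: q => [|q IHq]; rewrite ?addn0 // mulSnr addnA sN. Qed.

Lemma periodic_eqmod (p q : nat) : p = q %[mod N] -> s p = s q.
Proof.
move=> pq; rewrite (divn_eq p N) (divn_eq q N) pq.
by rewrite ![_ * N + _]addnC !periodic_mul.
Qed.

Lemma rankDmul (p q : nat) : rank s (p + q * N) = rank s p + q * rank s N.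
Proof.
elim: q => [|q IHq]; first by rewrite !addn0.
(* Peeling off the first period leaves a shifted count, which periodicity turns back into a rank. *)
rewrite mulSn addnCA rankD (_ : count s (iota N _) = rank s (p + q * N)); last first.
  rewrite -count_iotaD; apply: eq_count => k /=.
  by rewrite addnC sN.
by rewrite IHq mulSn addnCA.
Qed.

Lemma rank_eqmod (p q : nat) : p = q %[mod N] -> rank s p = rank s q %[mod rank s N].
Proof.
move=> pq; rewrite (divn_eq p N) (divn_eq q N) pq.
by rewrite ![_ * N + _]addnC !rankDmul ![_ + _ * rank s N]addnC !modnMDl.
Qed.

Lemma rank_eqmod_mul (Q p q : nat) :
  p = q %[mod Q * N] -> rank s p = rank s q %[mod Q * rank s N].
Proof.
move=> pq; rewrite (divn_eq p (Q * N)) (divn_eq q (Q * N)) pq.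
rewrite ![_ * (Q * N) + _]addnC !mulnA !rankDmul -!mulnA.
by rewrite ![_ + _ * (_ * _)]addnC !modnMDl.
Qed.

(** Modulo [N] the two positions differ by whole periods, and each period adds [rank s N] to the
    rank; cancelling this positive factor compares the numbers of periods modulo [Q]. *)
Lemma eqmod_rank (Q p q : nat) : 0 < rank s N ->
  p = q %[mod N] -> rank s p = rank s q %[mod Q * rank s N] ->
  p = q %[mod Q * N].
Proof.
move=> T0 pq; rewrite (divn_eq p N) (divn_eq q N) pq.
rewrite ![_ * N + _]addnC !rankDmul => /eqP.
rewrite eqn_modDl -!muln_modl eqn_pmul2r // => /eqP e.
by apply/eqP; rewrite eqn_modDl -!muln_modl e.
Qed.

(** Moving [p] by [r] periods keeps its class and adds [r] times [rank s N] to its rank, so every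
    target in the right residue class is reached. *)
Lemma rank_lift (Q p m : nat) : 0 < Q -> 0 < rank s N ->
  m = rank s p %[mod rank s N] ->
  exists2 q, q = p %[mod N] & rank s q = m %[mod Q * rank s N].
Proof.
move=> Q0 T0 mp; set T := rank s N in T0 mp *.
(* A multiple of [Q * T] is added to [m] so that the subtraction of [rank s p] is not truncated. *)
have le : rank s p <= rank s p * (Q * T) + m.
  by rewrite (leq_trans _ (leq_addr _ _)) // leq_pmulr // muln_gt0 Q0.
have /dvdnP[r rE] : T %| rank s p * (Q * T) + m - rank s p.
  by rewrite -eqn_mod_dvd // mulnA modnMDl mp.
exists (p + r * N); first by rewrite addnC modnMDl.
by rewrite rankDmul -/T -rE subnKC // modnMDl.
Qed.

End PeriodicRank.

(** * The filled word and its windows *)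

Lemma selectedD (N : nat) (S : {set 'I_N}) (p : nat) :
  selected S (p + N) = selected S p.
Proof. by rewrite /selected modnDr. Qed.

Lemma size_copies (a q : nat) (u : pword a) : size (copies q u) = q * size u.
Proof. by elim: q => // q IHq; rewrite /copies /= size_cat IHq. Qed.

Lemma nth_copies (a q : nat) (u : pword a) (p : nat) :
  p < q * size u -> nth None (copies q u) p = nth None u (p %% size u).
Proof.
elim: q p => // q IHq p; rewrite /copies /= nth_cat mulSn => pq.
have [pu | up] := ltnP p (size u); first by rewrite modn_small.
rewrite IHq; last by rewrite ltn_subLR.
by rewrite -[in RHS](subnK up) modnDr.
Qed.

Section Fill.

Variables (a Q : nat) (u : pword a) (S : {set 'I_(size u)}) (v : seq 'I_a).
Local Notation s := (selected S).
Local Notation T := (rank s (size u)).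
Local Notation w := (fill Q S v).
Hypotheses (Q0 : 0 < Q) (S0 : S != set0)
  (Snone : forall i : 'I_(size u), i \in S -> nth None u i = None)
  (size_v : size v = Q * T).

Lemma size_u_gt0 : 0 < size u.
Proof. by have /set0Pn[i _] := S0; case: i => i /=; case: (size u). Qed.

Lemma selected_gt0 : 0 < T.
Proof.
have /set0Pn[i iS] := S0; rewrite -has_count; apply/hasP; exists (val i).
  by rewrite mem_iota /=.
by apply/existsP; exists i; rewrite iS modn_small /=.
Qed.

Lemma selected_None (p : nat) : s p -> nth None u (p %% size u) = None.
Proof. by case/existsP => i /andP[iS /eqP <-]; apply: Snone. Qed.

Lemma size_fill : size w = Q * size u.
Proof. exact: size_mkseq. Qed.

(** One turn around [w] raises the rank by [Q * T], the size of [v], so reading [v] cyclically at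
    the rank is consistent for every index. *)
Lemma nth_fill (p : nat) :
  nth None w (p %% size w) =
  if s p then nth None (letters v) (rank s p %% size v)
  else nth None u (p %% size u).
Proof.
have w0 : 0 < Q * size u by rewrite muln_gt0 Q0 size_u_gt0.
rewrite size_fill nth_mkseq ?ltn_mod // nth_copies ?ltn_mod //.
rewrite (periodic_eqmod (@selectedD _ S) (q := p)) ?modn_dvdm ?dvdn_mull //.
case: ifP => // sp; congr nth.
rewrite -[LHS]/(rank s (p %% (Q * size u))).
have := @rank_eqmod_mul _ _ (@selectedD _ S) Q (p %% (Q * size u)) p (modn_mod _ _).
rewrite size_v => <-; rewrite [in RHS]modn_small //.
have sp' : s (p %% (Q * size u)).
  by rewrite (periodic_eqmod (@selectedD _ S) (q := p)) ?modn_dvdm ?dvdn_mull.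
have lt := ltn_pmod p w0.
have -> : Q * T = rank s (Q * size u).
  by rewrite -[in RHS](add0n (Q * _)) (rankDmul (@selectedD _ S)).
exact: ltn_rank.
Qed.

Variable (n delta : nat) (x0 : 'I_a).
Hypothesis hdelta : forall i : nat, count s (iota i n) = delta.

Definition selected_letters (i : nat) (x : seq 'I_a) : seq 'I_a :=
  [seq nth x0 x k | k <- iota 0 n & s (i + k)].

Lemma size_selected_letters (i : nat) (x : seq 'I_a) :
  size (selected_letters i x) == delta.
Proof.
by rewrite size_map size_filter count_iotaD hdelta.
Qed.

Lemma selected_letters_eqmod (i j : nat) (x : seq 'I_a) :
  i = j %[mod size u] -> selected_letters i x = selected_letters j x.
Proof.
move=> ij; congr map; apply: eq_filter => k.
by apply: (periodic_eqmod (@selectedD _ S)); rewrite -modnDml ij modnDml.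
Qed.

Lemma window_selected (i : nat) :
  window delta (letters v) (rank s i) =
  [seq nth None (letters v) (rank s (i + k) %% size v) | k <- iota 0 n & s (i + k)].
Proof.
rewrite (map_comp (fun m => nth None (letters v) (m %% size v))) map_rank_iota hdelta.
by rewrite /window /mkseq -[in RHS](addn0 (rank s i)) iotaDl -map_comp size_map.
Qed.

(** At unselected places [w] agrees with [u]; at selected ones [u] has a diamond, which imposes
    nothing, while [w] has a letter of [v], which must equal that of [x]. *)
Lemma covers_fill (i : nat) (x : n.-tuple 'I_a) :
  covers (window n w i) (letters x) =
  covers (window n u i) (letters x) &&
  (window delta (letters v) (rank s i) == letters (selected_letters i x)).
Proof.
have v0 : 0 < size v by rewrite size_v muln_gt0 Q0 selected_gt0.
rewrite window_selected /letters -map_comp -/(letters v).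
apply/covers_windowP/andP => [H | [/covers_windowP Hu /eqP/eq_in_map Hv] k].
  split.
    apply/covers_windowP => k /=; have := H k; rewrite /= nth_fill.
    by case: ifP => // /selected_None ->.
  apply/eqP/eq_in_map => k; rewrite mem_filter mem_iota => /andP[sk kn].
  have := H (Ordinal kn); rewrite /= nth_fill sk (tnth_nth x0) /=.
  by rewrite (nth_map x0) ?ltn_mod //= => /eqP.
rewrite /= nth_fill; case: ifP => [sk | _]; last exact: Hu.
rewrite Hv; last by rewrite mem_filter sk mem_iota ltn_ord.
by rewrite /= (tnth_nth x0) eqxx.
Qed.

Lemma exists_selected_letters (i : nat) (y : delta.-tuple 'I_a) :
  exists2 x : n.-tuple 'I_a,
    covers (window n u i) (letters x) & selected_letters i x = y.
Proof.
(* The rank difference counts the selected places of the window before [k]; unselected diamonds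
   receive the arbitrary letter [x0]. *)
pose f k := if s (i + k) then nth x0 y (rank s (i + k) - rank s i)
            else odflt x0 (nth None u ((i + k) %% size u)).
exists [tuple f k | k < n].
  apply/covers_windowP => k /=; rewrite tnth_mktuple /f.
  case: ifP => [/selected_None -> // | _].
  by case: (nth _ _ _) => [c|] //=; rewrite eqxx.
transitivity [seq nth x0 y (rank s (i + k) - rank s i) | k <- iota 0 n & s (i + k)].
  apply/eq_in_map => k; rewrite mem_filter mem_iota => /andP[sk kn].
  by rewrite -[k]/(val (Ordinal kn)) -tnth_nth tnth_mktuple /f sk.
rewrite (map_comp (fun m => nth x0 y (m - rank s i))) map_rank_iota hdelta.
rewrite -[X in iota X _]addn0 iotaDl -map_comp.
rewrite -[RHS](mkseq_nth x0) size_tuple; apply: eq_mkseq => k /=.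
by rewrite addKn.
Qed.

(** * The two implications, and the diamonds of the filled word *)

Hypothesis hu : is_upcycle n u.

Lemma perfect_necklace_upcycle :
  is_perfect_necklace delta T v -> is_upcycle n w.
Proof.
case=> _ hv x; have [i0 [ci0 _]] := hu x.
have w0 : 0 < size w by rewrite size_fill muln_gt0 Q0 size_u_gt0.
have jT : rank s i0 %% T < T by rewrite ltn_mod selected_gt0.
have v0 : 0 < size v by rewrite size_v muln_gt0 Q0 selected_gt0.
have [m [[mj mw] um]] := hv (Ordinal jT) (Tuple (size_selected_letters i0 x)).
have [i ii0 im] := rank_lift (@selectedD _ S) Q0 selected_gt0 (etrans mj (modn_mod _ _)).
have ci : covers (window n w i) (letters x).
  rewrite covers_fill (window_eqmod _ ii0) ci0 (selected_letters_eqmod _ ii0).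
  by rewrite -mw /=; apply/eqP/window_eqmod; rewrite [size (letters v)]size_map [in LHS]size_v im -size_v.
have iw : i %% size w < size w by rewrite ltn_mod.
exists (Ordinal iw); split=> /= [|i' ci'].
  by rewrite (@window_eqmod _ _ _ _ i) ?modn_mod.
apply: val_inj => /=; rewrite -[RHS](modn_small (ltn_ord i')).
(* Uniqueness: [i'] lies in the class of [i0], and its rank marks an occurrence in [v] with the same
   residue as [m], hence [m] itself. *)
suff e : i = i' %[mod Q * size u] by rewrite [in LHS]size_fill e -size_fill.
move: ci'; rewrite covers_fill => /andP[cu /eqP cv].
have i'i0 := upcycle_window_eqmod hu size_u_gt0 cu ci0.
apply: (eqmod_rank (@selectedD _ S) selected_gt0); first by rewrite ii0.
rewrite im -size_v modn_small //.
have mv : rank s i' %% size v < size v by rewrite ltn_mod.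
suff -> : m = Ordinal mv by [].
apply: um; split=> /=.
  rewrite modn_mod size_v modn_dvdm ?dvdn_mull //.
  exact: (rank_eqmod (@selectedD _ S)).
rewrite -(selected_letters_eqmod _ i'i0) -cv; apply: window_eqmod.
by rewrite [size (letters v)]size_map modn_mod.
Qed.

Lemma upcycle_perfect_necklace :
  size v = T * a ^ delta -> is_upcycle n w -> is_perfect_necklace delta T v.
Proof.
move=> size_v' hw; split=> // j y.
have v0 : 0 < size v by rewrite size_v muln_gt0 Q0 selected_gt0.
have w0 : 0 < size w by rewrite size_fill muln_gt0 Q0 size_u_gt0.
have [p pj] := rank_surj (ltnW (ltn_ord j)).
have [x cx xy] := exists_selected_letters p y.
have [i [ci _]] := hw x.
move: (ci); rewrite covers_fill => /andP[cu /eqP cv].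
have ip := upcycle_window_eqmod hu size_u_gt0 cu cx.
have mv : rank s i %% size v < size v by rewrite ltn_mod.
exists (Ordinal mv); split=> /= [|m [mj mw]].
  split.
    rewrite size_v modn_dvdm ?dvdn_mull // -pj.
    exact: (rank_eqmod (@selectedD _ S)).
  rewrite -xy -(selected_letters_eqmod _ ip) -cv; apply: window_eqmod.
  by rewrite [size (letters v)]size_map modn_mod.
rewrite -pj in mj.
(* A rival occurrence [m] lifts to a position [i'] whose window in [w] also covers [x], so [i']
   agrees with [i] modulo the size of [w]. *)
have [i' i'p i'm] := rank_lift (@selectedD _ S) Q0 selected_gt0 mj.
have ci' : covers (window n w i') (letters x).
  rewrite covers_fill (window_eqmod _ i'p) cx (selected_letters_eqmod _ i'p) xy.
  by rewrite -mw; apply/eqP/window_eqmod; rewrite [size (letters v)]size_map [in LHS]size_v i'm -size_v.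
apply: val_inj => /=; rewrite -[RHS](modn_small (ltn_ord m)).
suff e : rank s i = m %[mod Q * T] by rewrite [in LHS]size_v e -size_v.
rewrite -i'm.
apply: (rank_eqmod_mul (@selectedD _ S)).
by rewrite -size_fill; apply: upcycle_window_eqmod ci ci'.
Qed.

Lemma count_None_fill (i : nat) :
  count (pred1 None) (window n w i) + delta = count (pred1 None) (window n u i).
Proof.
have v0 : 0 < size v by rewrite size_v muln_gt0 Q0 selected_gt0.
rewrite !count_map -(hdelta i) -(count_iotaD s).
(* Diamonds of [w] and selected places are disjoint, and their union is the set of diamonds of
   [u]. *)
rewrite -count_predUI [X in _ + X](_ : _ = 0) ?addn0.
  apply: eq_count => k /=; rewrite nth_fill.
  by case: ifP => [/selected_None -> | _]; rewrite ?orbT ?orbF.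
apply/eqP; rewrite -leqn0 leqNgt -has_count; apply/hasPn => k _ /=.
rewrite nth_fill; case: (s (i + k)); rewrite ?andbF // andbT.
by rewrite (nth_map x0) // ltn_mod.
Qed.

Lemma copies_covers_fill : covers (copies Q u) w.
Proof.
rewrite /covers all2E size_copies size_fill eqxx /=.
apply/(all_nthP (None, None)) => p.
rewrite size_zip size_copies size_fill minnn => pw.
rewrite nth_zip ?size_copies ?size_fill //= nth_copies // nth_mkseq // nth_copies //.
by case: ifP => [/selected_None -> // | _]; rewrite eqxx orbT.
Qed.

End Fill.

Theorem theorem6p3 (a n d delta : nat) (u : pword a) (S : {set 'I_(size u)})
    (v : seq 'I_a)
    (ha : 2 <= a) (hn : 1 <= n)
    (hu : is_upcycle n u) (hd : has_diamondicity n u d)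
    (hS0 : S != set0)
    (hSdiamond : forall i : 'I_(size u), i \in S -> nth None u i = None)
    (hSperiodic : periodic n S)
    (hdelta : forall i : nat, count (selected S) (iota i n) = delta)
    (hv : size v = (delta * a ^ (n - d)) %/ n * a ^ delta) :
  let w := fill (a ^ delta) S v in
  (is_upcycle n w <->
     is_perfect_necklace delta ((delta * a ^ (n - d)) %/ n) v) /\
  (is_upcycle n w -> is_lift n u w /\ has_diamondicity n w (d - delta)).
Proof.
have a0 : 0 < a by apply: ltnW.
have Q0 : 0 < a ^ delta by rewrite expn_gt0 a0.
(* Both sides count the selected positions below n * size u. *)
have Tn : rank (selected S) (size u) * n = delta * size u.
  have selN q : rank (selected S) (q * n) = q * delta.
    by elim: q => // q IHq; rewrite mulSnr rankD hdelta IHq mulSnr.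
  by rewrite [RHS]mulnC -selN [in RHS]mulnC (rankDmul (@selectedD _ S) 0) mulnC.
(* By [Tn] the division by [n] is exact. *)
have tE : (delta * a ^ (n - d)) %/ n = rank (selected S) (size u).
  by rewrite -(upcycle_size a0 hu hd) -Tn mulnK.
rewrite tE in hv *; have size_v := hv; rewrite mulnC in size_v.
have x0 : 'I_a := Ordinal a0.
move=> w; split.
  split; first exact: (upcycle_perfect_necklace Q0 hS0 hSdiamond size_v x0 hdelta hu hv).
  exact: (perfect_necklace_upcycle Q0 hS0 hSdiamond size_v x0 hdelta hu).
have delta0 : 0 < delta.
  have := selected_gt0 hS0; rewrite -(ltn_pmul2r hn) mul0n Tn.
  by rewrite muln_gt0 => /andP[].
have dw i : count (pred1 None) (window n w i) + delta = d.
  by rewrite (count_None_fill Q0 hS0 hSdiamond size_v x0 hdelta) hd.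
have hdw : has_diamondicity n w (d - delta) by move=> i; rewrite -(dw i) addnK.
have le_delta : delta <= d by rewrite -(dw 0) leq_addl.
move=> hw; split=> //; exists d, (d - delta); split=> //.
  by rewrite ltn_subrL delta0 (leq_trans delta0).
(* The copies of [u] and [w] are already aligned, so the trivial rotation serves. *)
by rewrite subKn //; exists 0; rewrite rot0; apply: copies_covers_fill.
Qed.
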